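(* Let $G\subset\mathbb{R}^3$ be a domain and let $f:G\to\mathbb{C}$ be a nonvanishing twice continuously differentiable function. Let $W=W_0+\mathbf W$ be an $\mathbb{H}(\mathbb{C})$-valued solution in $G$ of the equation $$\left(D-\frac{Df}{f}C_H\right)W=0 .$$ Then $W_0$ is a solution of the stationary Schrödinger equation $$-\Delta W_0+\nu W_0=0,\qquad\text{where }\nu=\frac{\Delta f}{f}.$$ Moreover, the function $u=f^{-1}W_0$ is a solution of the equation $$\operatorname{div}(f^2\operatorname{grad}u)=0,$$ and the vector function $\mathbf v=f\mathbf W$ is a solution of the equation $$\operatorname{rot}(f^{-2}\operatorname{rot}\mathbf v)=0 .$$
   Context: $\mathbb{H}(\mathbb{C})$ is the algebra of complex quaternions $Q=Q_0+\mathbf Q$ with scalar part $Q_0\in\mathbb{C}$ and vector part $\mathbf Q=Q_1\mathbf i+Q_2\mathbf j+Q_3\mathbf k$, $Q_1,Q_2,Q_3\in\mathbb{C}$, where $\mathbf i,\mathbf j,\mathbf k$ are the quaternionic imaginary units, commuting with the complex imaginary unit $i$; purely vectorial elements are identified with vectors in $\mathbb{C}^3$. Quaternionic conjugation: $C_HQ=\overline Q=Q_0-\mathbf Q$. For differentiable $\mathbb{H}(\mathbb{C})$-valued $Q$ of $(x,y,z)$, $DQ=\mathbf i\,\partial_xQ+\mathbf j\,\partial_yQ+\mathbf k\,\partial_zQ$ (for scalar $f$, $Df$ is identified with $\operatorname{grad}f$). $\frac{Df}{f}C_HW$ means the quaternionic product $\frac{Df}{f}\cdot\overline W$. $\Delta=\partial_x^2+\partial_y^2+\partial_z^2$;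 $\operatorname{rot}$ is the curl. Solutions are understood in the classical sense, as twice continuously differentiable functions. *)

(* Defs.v *)
From Stdlib Require Import Reals.
From Coquelicot Require Import Coquelicot.

Open Scope C_scope.

Definition R3 : Type := (R * R * R)%type.

Inductive axis : Set := Ax | Ay | Az.

Definition coord (a : axis) (p : R3) : R :=
  let '(x, y, z) := p in
  match a with Ax => x | Ay => y | Az => z end.

(** The function [f] restricted to the line through [p] parallel to the axis
    [a], parametrized by the coordinate along [a]; [p] itself is at parameter
    [coord a p]. *)
Definition along {T : Type} (a : axis) (f : R3 -> T) (p : R3) (t : R) : T :=
  let '(x, y, z) := p in
  match a with Ax => f (t, y, z) | Ay => f (x, t, z) | Az => f (x, y, t) end.

(** Coquelicot's [is_connected] is restricted to subsets of [R]. *)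
Definition connected_set {T : UniformSpace} (G : T -> Prop) : Prop :=
  forall A B : T -> Prop,
    open A -> open B ->
    (forall p, G p -> A p \/ B p) ->
    (exists p, G p /\ A p) ->
    (exists p, G p /\ B p) ->
    exists p, G p /\ A p /\ B p.

Definition is_domain (G : R3 -> Prop) : Prop :=
  open G /\ (exists p, G p) /\ connected_set G.

(** Derivative of a complex-valued function of a real variable.  [Derive] is
    total and only defined on real-valued functions; the value is meaningful
    when [ex_derive] holds. *)
Definition DeriveRC (g : R -> C) (t : R) : C :=
  (Derive (fun s => Re (g s)) t, Derive (fun s => Im (g s)) t).

Definition ex_partial (a : axis) (f : R3 -> C) (p : R3) : Prop :=
  @ex_derive R_AbsRing C_R_NormedModule (along a f p) (coord a p).

Definition partial (a : axis) (f : R3 -> C) (p : R3) : C :=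
  DeriveRC (along a f p) (coord a p).

(** A function on an open set [G] is represented by a total function of which
    only the values on [G] matter; all notions below are local, so they do not
    depend on the extension. *)
Fixpoint Ck (n : nat) (G : R3 -> Prop) (f : R3 -> C) : Prop :=
  (forall p, G p -> @continuous _ C_UniformSpace f p) /\
  match n with
  | O => True
  | S m => forall a, (forall p, G p -> ex_partial a f p) /\ Ck m G (partial a f)
  end.

Definition laplacian (f : R3 -> C) (p : R3) : C :=
  partial Ax (partial Ax f) p + partial Ay (partial Ay f) p
  + partial Az (partial Az f) p.

Record C3 : Type := vec { v1 : C; v2 : C; v3 : C }.

Definition vzero : C3 := vec 0 0 0.

Definition vscal (c : C) (v : C3) : C3 := vec (c * v1 v) (c * v2 v) (c * v3 v).

Definition CkV (n : nat) (G : R3 -> Prop) (v : R3 -> C3) : Prop :=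
  Ck n G (fun p => v1 (v p)) /\ Ck n G (fun p => v2 (v p)) /\
  Ck n G (fun p => v3 (v p)).

Definition grad (f : R3 -> C) (p : R3) : C3 :=
  vec (partial Ax f p) (partial Ay f p) (partial Az f p).

Definition div (v : R3 -> C3) (p : R3) : C :=
  partial Ax (fun r => v1 (v r)) p + partial Ay (fun r => v2 (v r)) p
  + partial Az (fun r => v3 (v r)) p.

Definition rot (v : R3 -> C3) (p : R3) : C3 :=
  vec (partial Ay (fun r => v3 (v r)) p - partial Az (fun r => v2 (v r)) p)
      (partial Az (fun r => v1 (v r)) p - partial Ax (fun r => v3 (v r)) p)
      (partial Ax (fun r => v2 (v r)) p - partial Ay (fun r => v1 (v r)) p).

(** Complex quaternions [q0 + q1 i + q2 j + q3 k]. *)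
Record HC : Type := quat { q0 : C; q1 : C; q2 : C; q3 : C }.

Definition Vec (Q : HC) : C3 := vec (q1 Q) (q2 Q) (q3 Q).

Definition qscalar (c : C) : HC := quat c 0 0 0.
Definition qi : HC := quat 0 1 0 0.
Definition qj : HC := quat 0 0 1 0.
Definition qk : HC := quat 0 0 0 1.

Definition qadd (P Q : HC) : HC :=
  quat (q0 P + q0 Q) (q1 P + q1 Q) (q2 P + q2 Q) (q3 P + q3 Q).

Definition qsub (P Q : HC) : HC :=
  quat (q0 P - q0 Q) (q1 P - q1 Q) (q2 P - q2 Q) (q3 P - q3 Q).

Definition qmul (P Q : HC) : HC :=
  quat (q0 P * q0 Q - q1 P * q1 Q - q2 P * q2 Q - q3 P * q3 Q)
       (q0 P * q1 Q + q1 P * q0 Q + q2 P * q3 Q - q3 P * q2 Q)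
       (q0 P * q2 Q - q1 P * q3 Q + q2 P * q0 Q + q3 P * q1 Q)
       (q0 P * q3 Q + q1 P * q2 Q - q2 P * q1 Q + q3 P * q0 Q).

Definition qdiv (P : HC) (c : C) : HC :=
  quat (q0 P / c) (q1 P / c) (q2 P / c) (q3 P / c).

Definition qconj (Q : HC) : HC := quat (q0 Q) (- q1 Q) (- q2 Q) (- q3 Q).

Lemma quaternion_units :
  qmul qi qi = qscalar (- (1)) /\ qmul qj qj = qscalar (- (1)) /\
  qmul qk qk = qscalar (- (1)) /\
  qmul qi qj = qk /\ qmul qj qk = qi /\ qmul qk qi = qj /\
  qmul qj qi = qconj qk /\ qmul qk qj = qconj qi /\ qmul qi qk = qconj qj.
Proof.
  assert (H : forall P Q : HC, q0 P = q0 Q -> q1 P = q1 Q -> q2 P = q2 Q ->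
    q3 P = q3 Q -> P = Q).
  { intros [] [] ; simpl; intros; subst; reflexivity. }
  repeat split; apply H; simpl; ring.
Qed.

Definition CkQ (n : nat) (G : R3 -> Prop) (W : R3 -> HC) : Prop :=
  Ck n G (fun p => q0 (W p)) /\ CkV n G (fun p => Vec (W p)).

Definition qpartial (a : axis) (W : R3 -> HC) (p : R3) : HC :=
  quat (partial a (fun r => q0 (W r)) p) (partial a (fun r => q1 (W r)) p)
       (partial a (fun r => q2 (W r)) p) (partial a (fun r => q3 (W r)) p).

(** The Moisil-Teodoresco operator [D]. *)
Definition MT (W : R3 -> HC) (p : R3) : HC :=
  qadd (qadd (qmul qi (qpartial Ax W p)) (qmul qj (qpartial Ay W p)))
       (qmul qk (qpartial Az W p)).

(* Main.v *)
Require Import Defs.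
From Stdlib Require Import Reals Lra.
From Coquelicot Require Import Coquelicot.

Open Scope C_scope.

(** Write [u = W0 / f] and [v = f Vec(W)].  The vector part of the equation
    [D W = (Df / f) conj W] reads

      [grad W0 + rot Vec(W) = (W0 grad f - grad f x Vec(W)) / f],

    and multiplying it by [f] turns it into the single first-order identity

      [rot v = - f^2 grad u]

    ([rot_f_vec_part]).  Taking the divergence and using [div rot = 0] gives
    [div (f^2 grad u) = 0]; dividing by [f^2], taking the rotation and using
    [rot grad = 0] gives [rot (f^(-2) rot v) = 0].  Finally
    [f^2 grad u = f grad W0 - W0 grad f], whose divergence is
    [f Delta W0 - W0 Delta f] ([div_f2_grad_quotient]); its vanishing, divided
    by [f], is the Schroedinger equation for [W0].

    The two identities [div rot = 0] and [rot grad = 0] rest on the symmetry of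
    second partial derivatives of functions of class [C^2] ([partial_comm]),
    deduced from the two-dimensional real Schwarz theorem applied to real and
    imaginary parts in each coordinate plane.  The smoothness claims follow
    from the stability of the classes [Ck] under sums, products and inverses of
    nonvanishing functions, proved by induction on the order of smoothness. *)

(** * Complex-valued functions of a real variable *)

(** [g] has derivative [l] at [t], expressed through real and imaginary parts. *)
Definition is_deriveRC (g : R -> C) (t : R) (l : C) : Prop :=
  is_derive (fun s => Re (g s)) t (Re l) /\
  is_derive (fun s => Im (g s)) t (Im l).

Lemma is_deriveRC_plus g h t dg dh :
  is_deriveRC g t dg -> is_deriveRC h t dh ->
  is_deriveRC (fun s => g s + h s) t (dg + dh).
Proof.
  intros [g1 g2] [h1 h2]; split.
  - exact (is_derive_plus _ _ _ _ _ g1 h1).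
  - exact (is_derive_plus _ _ _ _ _ g2 h2).
Qed.

Lemma is_deriveRC_opp g t dg :
  is_deriveRC g t dg -> is_deriveRC (fun s => - g s) t (- dg).
Proof.
  intros [g1 g2]; split.
  - exact (is_derive_opp _ _ _ g1).
  - exact (is_derive_opp _ _ _ g2).
Qed.

Lemma is_deriveRC_mult g h t dg dh :
  is_deriveRC g t dg -> is_deriveRC h t dh ->
  is_deriveRC (fun s => g s * h s) t (dg * h t + g t * dh).
Proof.
  intros [g1 g2] [h1 h2].
  assert (M : forall a b da db, is_derive a t da -> is_derive b t db ->
    is_derive (fun s => (a s * b s)%R) t (da * b t + a t * db)%R).
  { intros a b da db Ha Hb; exact (is_derive_mult a b t da db Ha Hb Rmult_comm). }
  split.
  - evar_last.
    + exact (is_derive_minus _ _ _ _ _ (M _ _ _ _ g1 h1) (M _ _ _ _ g2 h2)).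
    + unfold minus, plus, opp, Re, Im; simpl; ring.
  - evar_last.
    + exact (is_derive_plus _ _ _ _ _ (M _ _ _ _ g1 h2) (M _ _ _ _ g2 h1)).
    + unfold plus, Re, Im; simpl; ring.
Qed.

Lemma Cnorm2_neq_0 (z : C) : z <> 0 -> (Re z ^ 2 + Im z ^ 2 <> 0)%R.
Proof.
  intros Hz H; apply Hz; destruct z as [a b]; simpl in H.
  apply injective_projections; simpl; nra.
Qed.

Lemma is_deriveRC_inv g t dg :
  is_deriveRC g t dg -> g t <> 0 ->
  is_deriveRC (fun s => / g s) t (- dg * / g t * / g t).
Proof.
  intros [g1 g2] Hg.
  assert (N := Cnorm2_neq_0 _ Hg).
  assert (DN : is_derive (fun s => (Re (g s) ^ 2 + Im (g s) ^ 2)%R) t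
    (2 * Re (g t) * Re dg + 2 * Im (g t) * Im dg)%R).
  { evar_last.
    - exact (is_derive_plus _ _ _ _ _
        (is_derive_pow _ 2 _ _ g1) (is_derive_pow _ 2 _ _ g2)).
    - unfold plus; simpl; ring. }
  split.
  - evar_last.
    + exact (is_derive_div _ _ _ _ _ g1 DN N).
    + unfold Re, Im in *; simpl in *; field; intros E; apply N; rewrite <- E; ring.
  - evar_last.
    + exact (is_derive_div _ _ _ _ _ (is_derive_opp _ _ _ g2) DN N).
    + unfold opp, Re, Im in *; simpl in *; field; intros E; apply N; rewrite <- E; ring.
Qed.

(** Differentiability for the real normed space structure of the complex
    numbers is differentiability of both components. *)
Lemma ex_derive_C (g : R -> C) (t : R) :
  @ex_derive R_AbsRing C_R_NormedModule g t <->
  ex_derive (fun s => Re (g s)) t /\ ex_derive (fun s => Im (g s)) t.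
Proof.
  split.
  - intros [l Hl]; split.
    + exists (Re l).
      eapply filterdiff_ext_lin.
      * exact (filterdiff_comp' g (@fst R R) t _ _ Hl
          (filterdiff_linear _ (is_linear_fst (K := R_AbsRing)
            (U := R_NormedModule) (V := R_NormedModule)))).
      * intros y; reflexivity.
    + exists (Im l).
      eapply filterdiff_ext_lin.
      * exact (filterdiff_comp' g (@snd R R) t _ _ Hl
          (filterdiff_linear _ (is_linear_snd (K := R_AbsRing)
            (U := R_NormedModule) (V := R_NormedModule)))).
      * intros y; reflexivity.
  - intros [[a Ha] [b Hb]].
    exists ((a, b) : C).
    eapply filterdiff_ext_lin; [eapply filterdiff_ext|].
    2: { refine (filterdiff_comp'_2 (K := R_AbsRing) (T := R_NormedModule)
          (U := R_NormedModule) (V := R_NormedModule) (W := C_R_NormedModule)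
          (fun s => Re (g s)) (fun s => Im (g s)) (fun x y => (x, y)) t
          _ _ (fun x y => (x, y)) Ha Hb _).
         apply (filterdiff_ext_lin _ (fun p => p)).
         - apply (filterdiff_ext (fun p => p)).
           + intros [x y]; reflexivity.
           + apply filterdiff_id.
         - intros [x y]; reflexivity. }
    + intros s; simpl; destruct (g s); reflexivity.
    + intros s; reflexivity.
Qed.

(** * Partial derivatives *)

(** [l] is the value at [p] of the partial derivative of [f] along the axis
    [a]; this relation includes the existence of the derivative. *)
Definition is_partial (a : axis) (f : R3 -> C) (p : R3) (l : C) : Prop :=
  is_deriveRC (along a f p) (coord a p) l.

Lemma is_partial_unique a f p l : is_partial a f p l -> partial a f p = l.
Proof.
  intros [H1 H2]; apply is_derive_unique in H1, H2.
  apply injective_projections; assumption.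
Qed.

Lemma is_partial_ex a f p l : is_partial a f p l -> ex_partial a f p.
Proof.
  intros [H1 H2]; apply ex_derive_C; split; eexists; eassumption.
Qed.

Lemma ex_partial_correct a f p :
  ex_partial a f p -> is_partial a f p (partial a f p).
Proof.
  intros H; apply ex_derive_C in H; destruct H.
  split; apply Derive_correct; assumption.
Qed.

Lemma is_partial_const a c p : is_partial a (fun _ => c) p 0.
Proof.
  destruct p as [[x y] z], a; split;
    exact (is_derive_const (V := R_NormedModule) _ _).
Qed.

Lemma is_partial_plus a f g p df dg :
  is_partial a f p df -> is_partial a g p dg ->
  is_partial a (fun r => f r + g r) p (df + dg).
Proof.
  destruct p as [[x y] z], a; apply is_deriveRC_plus.
Qed.

Lemma is_partial_opp a f p df :
  is_partial a f p df -> is_partial a (fun r => - f r) p (- df).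
Proof.
  destruct p as [[x y] z], a; apply is_deriveRC_opp.
Qed.

Lemma is_partial_mult a f g p df dg :
  is_partial a f p df -> is_partial a g p dg ->
  is_partial a (fun r => f r * g r) p (df * g p + f p * dg).
Proof.
  destruct p as [[x y] z], a; apply is_deriveRC_mult.
Qed.

Lemma is_partial_inv a f p df :
  is_partial a f p df -> f p <> 0 ->
  is_partial a (fun r => / f r) p (- df * / f p * / f p).
Proof.
  destruct p as [[x y] z], a; apply is_deriveRC_inv.
Qed.

Lemma locally_along (a : axis) (P : R3 -> Prop) (p : R3) :
  locally p P -> locally (coord a p) (along a P p).
Proof.
  destruct p as [[x y] z]; intros [e He].
  exists e; intros t Ht; destruct a; apply He; repeat split; simpl;
    first [exact Ht | apply ball_center].
Qed.

Lemma is_partial_ext_loc a f g p l :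
  locally p (fun r => f r = g r) -> is_partial a f p l -> is_partial a g p l.
Proof.
  intros E [H1 H2]; apply (locally_along a) in E.
  split; (eapply is_derive_ext_loc; [|eassumption]);
    revert E; apply filter_imp; intros t; destruct p as [[x y] z], a; simpl;
    intros ->; reflexivity.
Qed.

(** * Continuity of complex-valued functions *)

Lemma continuous_C {U : UniformSpace} (f : U -> C) (x : U) :
  @continuous U C_UniformSpace f x <->
  continuous (fun r => Re (f r)) x /\ continuous (fun r => Im (f r)) x.
Proof.
  split.
  - intros H; split.
    + apply (@continuous_comp U C_UniformSpace R_UniformSpace f fst x H).
      destruct (f x); apply continuous_fst.
    + apply (@continuous_comp U C_UniformSpace R_UniformSpace f snd x H).
      destruct (f x); apply continuous_snd.
  - intros [H1 H2].
    apply (continuous_ext (fun r => (Re (f r), Im (f r)) : C_UniformSpace)).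
    { intros r; simpl; destruct (f r); reflexivity. }
    apply (continuous_comp_2 (V := R_UniformSpace) (W := R_UniformSpace)
      (X := C_UniformSpace) _ _ (fun a b => (a, b)) x H1 H2).
    apply (continuous_ext (fun p => p)); [now intros []|].
    apply continuous_id.
Qed.

Lemma continuous_Cplus {U : UniformSpace} (f g : U -> C) (x : U) :
  @continuous U C_UniformSpace f x -> @continuous U C_UniformSpace g x ->
  @continuous U C_UniformSpace (fun r => f r + g r) x.
Proof.
  intros Hf Hg; apply continuous_C in Hf, Hg.
  destruct Hf, Hg; apply continuous_C; split; simpl.
  - now apply (continuous_plus (fun r => Re (f r)) (fun r => Re (g r))).
  - now apply (continuous_plus (fun r => Im (f r)) (fun r => Im (g r))).
Qed.

Lemma continuous_Copp {U : UniformSpace} (f : U -> C) (x : U) :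
  @continuous U C_UniformSpace f x ->
  @continuous U C_UniformSpace (fun r => - f r) x.
Proof.
  intros Hf; apply continuous_C in Hf.
  destruct Hf; apply continuous_C; split; simpl.
  - now apply (continuous_opp (fun r => Re (f r))).
  - now apply (continuous_opp (fun r => Im (f r))).
Qed.

Lemma continuous_Cmult {U : UniformSpace} (f g : U -> C) (x : U) :
  @continuous U C_UniformSpace f x -> @continuous U C_UniformSpace g x ->
  @continuous U C_UniformSpace (fun r => f r * g r) x.
Proof.
  intros Hf Hg; apply continuous_C in Hf, Hg.
  destruct Hf, Hg; apply continuous_C; split; simpl.
  - apply (continuous_minus (fun r => Re (f r) * Re (g r))%R
      (fun r => Im (f r) * Im (g r))%R);
      apply (@continuous_mult _ R_AbsRing); assumption.
  - apply (continuous_plus (fun r => Re (f r) * Im (g r))%R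
      (fun r => Im (f r) * Re (g r))%R);
      apply (@continuous_mult _ R_AbsRing); assumption.
Qed.

Lemma continuous_Cinv {U : UniformSpace} (f : U -> C) (x : U) :
  @continuous U C_UniformSpace f x -> f x <> 0 ->
  @continuous U C_UniformSpace (fun r => / f r) x.
Proof.
  intros Hf Hf0; apply continuous_C in Hf.
  destruct Hf as [H1 H2]; apply continuous_C.
  assert (HN : continuous (fun r => (/ (Re (f r) ^ 2 + Im (f r) ^ 2))%R) x).
  { apply (continuous_comp (fun r => (Re (f r) ^ 2 + Im (f r) ^ 2)%R) Rinv);
      [|now apply continuous_Rinv, Cnorm2_neq_0].
    assert (Sq : forall h : U -> R, continuous h x ->
      continuous (fun r => (h r ^ 2)%R) x).
    { intros h Hh; apply (continuous_ext (fun r => (h r * h r)%R)).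
      - intros r; simpl; ring.
      - exact (@continuous_mult _ R_AbsRing h h x Hh Hh). }
    exact (@continuous_plus U R_AbsRing R_NormedModule
      (fun r => Re (f r) ^ 2)%R (fun r => Im (f r) ^ 2)%R x
      (Sq _ H1) (Sq _ H2)). }
  split; simpl; apply (@continuous_mult _ R_AbsRing); auto.
  now apply (continuous_opp (fun r => Im (f r))).
Qed.

(** * Locality *)

Section OnOpen.

Variables (G : R3 -> Prop) (oG : open G).

Lemma open_eq_locally (f g : R3 -> C) p :
  (forall r, G r -> f r = g r) -> G p -> locally p (fun r => f r = g r).
Proof.
  intros E Gp; generalize (oG p Gp); apply filter_imp; exact E.
Qed.

Lemma partial_ext_open a f g p :
  (forall r, G r -> f r = g r) -> G p -> partial a f p = partial a g p.
Proof.
  intros E Gp; apply (open_eq_locally _ _ p) in E; [|exact Gp].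
  apply (locally_along a) in E.
  unfold partial, DeriveRC; f_equal; apply Derive_ext_loc;
    revert E; apply filter_imp; intros t; destruct p as [[x y] z], a; simpl;
    intros ->; reflexivity.
Qed.

Lemma ex_partial_ext_open a f g p :
  (forall r, G r -> f r = g r) -> G p -> ex_partial a f p -> ex_partial a g p.
Proof.
  intros E Gp H.
  apply (is_partial_ex _ _ _ (partial a f p)).
  apply (is_partial_ext_loc a f); [now apply open_eq_locally|].
  now apply ex_partial_correct.
Qed.

(** * Closure of the classes [Ck] *)

Lemma Ck_ext n f g : (forall r, G r -> f r = g r) -> Ck n G f -> Ck n G g.
Proof.
  revert f g; induction n as [|n IH]; intros f g E [Hc Hd]; split.
  1, 3: intros p Gp; apply (continuous_ext_loc _ f);
    [now apply open_eq_locally | now apply Hc].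
  - exact I.
  - intros a; destruct (Hd a) as [He Hk]; split.
    + intros p Gp; apply (ex_partial_ext_open a f); auto.
    + apply (IH (partial a f)); [|exact Hk].
      intros r Gr; now apply partial_ext_open.
Qed.

Lemma Ck_S n f : Ck (S n) G f -> Ck n G f.
Proof.
  revert f; induction n as [|n IH]; intros f [Hc Hd]; split; auto.
  intros a; destruct (Hd a); split; auto.
Qed.

Lemma Ck_partial n a f : Ck (S n) G f -> Ck n G (partial a f).
Proof. intros [_ H]; apply H. Qed.

Lemma Ck_is_partial n a f p :
  Ck (S n) G f -> G p -> is_partial a f p (partial a f p).
Proof. intros [_ H] Gp; apply ex_partial_correct, H, Gp. Qed.

(** A continuous function whose partial derivatives are of class [C^n] is of
    class [C^(n+1)]. *)
Lemma Ck_intro n f (df : axis -> R3 -> C) :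
  (forall p, G p -> @continuous _ C_UniformSpace f p) ->
  (forall a p, G p -> is_partial a f p (df a p)) ->
  (forall a, Ck n G (df a)) -> Ck (S n) G f.
Proof.
  intros Hc Hd Hk; split; [exact Hc|]; intros a; split.
  - intros p Gp; eapply is_partial_ex; eauto.
  - apply (Ck_ext n (df a)); [|apply Hk].
    intros r Gr; symmetry; apply is_partial_unique; auto.
Qed.

Lemma Ck_plus n f g : Ck n G f -> Ck n G g -> Ck n G (fun r => f r + g r).
Proof.
  revert f g; induction n as [|n IH]; intros f g Hf Hg.
  - destruct Hf, Hg; split; auto using continuous_Cplus.
  - apply (Ck_intro n _ (fun a r => partial a f r + partial a g r)).
    + destruct Hf, Hg; auto using continuous_Cplus.
    + intros a p Gp; apply is_partial_plus; eapply Ck_is_partial; eauto.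
    + intros a; apply IH; now apply Ck_partial.
Qed.

Lemma Ck_opp n f : Ck n G f -> Ck n G (fun r => - f r).
Proof.
  revert f; induction n as [|n IH]; intros f Hf.
  - destruct Hf; split; auto using continuous_Copp.
  - apply (Ck_intro n _ (fun a r => - partial a f r)).
    + destruct Hf; auto using continuous_Copp.
    + intros a p Gp; apply is_partial_opp; eapply Ck_is_partial; eauto.
    + intros a; apply IH; now apply Ck_partial.
Qed.

Lemma Ck_minus n f g : Ck n G f -> Ck n G g -> Ck n G (fun r => f r - g r).
Proof. intros Hf Hg; apply Ck_plus; [|apply Ck_opp]; assumption. Qed.

Lemma Ck_mult n f g : Ck n G f -> Ck n G g -> Ck n G (fun r => f r * g r).
Proof.
  revert f g; induction n as [|n IH]; intros f g Hf Hg.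
  - destruct Hf, Hg; split; auto using continuous_Cmult.
  - apply (Ck_intro n _ (fun a r => partial a f r * g r + f r * partial a g r)).
    + destruct Hf, Hg; auto using continuous_Cmult.
    + intros a p Gp; apply is_partial_mult; eapply Ck_is_partial; eauto.
    + intros a; apply Ck_plus; apply IH;
        auto using Ck_partial, Ck_S.
Qed.

Lemma Ck_inv n (f : R3 -> C) :
  (forall p, G p -> f p <> 0) -> Ck n G f -> Ck n G (fun r => / f r).
Proof.
  intros Hf0.
  induction n as [|n IH]; intros Hf.
  - destruct Hf; split; auto using continuous_Cinv.
  - apply (Ck_intro n _ (fun a r => - partial a f r * / f r * / f r)).
    + destruct Hf; auto using continuous_Cinv.
    + intros a p Gp; apply is_partial_inv; auto; eapply Ck_is_partial; eauto.
    + intros a; assert (Hi := IH (Ck_S _ _ Hf)).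
      apply Ck_mult; [apply Ck_mult|]; auto.
      now apply Ck_opp, Ck_partial.
Qed.

End OnOpen.

(** * Symmetry of second partial derivatives *)

(** Schwarz's theorem for a complex-valued function of two real variables whose
    partial derivatives are taken on a neighbourhood [D] of [(x, y)]. *)
Lemma schwarz_plane (F : R -> R -> C) (D : R * R -> Prop) (x y : R) :
  locally (x, y) D ->
  (forall u v, D (u, v) ->
     @ex_derive R_AbsRing C_R_NormedModule (fun s => F s v) u /\
     @ex_derive R_AbsRing C_R_NormedModule (fun t => F u t) v /\
     @ex_derive R_AbsRing C_R_NormedModule (fun s => DeriveRC (F s) v) u /\
     @ex_derive R_AbsRing C_R_NormedModule
       (fun t => DeriveRC (fun s => F s t) u) v) ->
  @continuous _ C_UniformSpace
    (fun w => DeriveRC (fun s => DeriveRC (F s) (snd w)) (fst w)) (x, y) ->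
  @continuous _ C_UniformSpace
    (fun w => DeriveRC (fun t => DeriveRC (fun s => F s t) (fst w)) (snd w))
    (x, y) ->
  DeriveRC (fun s => DeriveRC (F s) y) x =
  DeriveRC (fun t => DeriveRC (fun s => F s t) x) y.
Proof.
  intros [e He] Hd Hc1 Hc2.
  apply continuous_C in Hc1, Hc2; destruct Hc1, Hc2.
  apply injective_projections.
  - apply (Schwarz (fun s t => Re (F s t))).
    + exists e; intros u v Hu Hv.
      destruct (Hd u v (He (u, v) (conj Hu Hv))) as (H3 & H4 & H5 & H6).
      apply ex_derive_C in H3, H4, H5, H6.
      repeat split; [apply H3 | apply H4 | apply H5 | apply H6].
    + apply continuity_2d_pt_filterlim; assumption.
    + apply continuity_2d_pt_filterlim; assumption.
  - apply (Schwarz (fun s t => Im (F s t))).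
    + exists e; intros u v Hu Hv.
      destruct (Hd u v (He (u, v) (conj Hu Hv))) as (H3 & H4 & H5 & H6).
      apply ex_derive_C in H3, H4, H5, H6.
      repeat split; [apply H3 | apply H4 | apply H5 | apply H6].
    + apply continuity_2d_pt_filterlim; assumption.
    + apply continuity_2d_pt_filterlim; assumption.
Qed.

(** Each pair of distinct axes spans a coordinate plane through the point; the
    embedding [e] of that plane pulls the open set [G] and the continuity of the
    second derivatives back to two variables. *)
Lemma partial_comm (G : R3 -> Prop) (oG : open G) a b f p :
  Ck 2 G f -> G p -> partial a (partial b f) p = partial b (partial a f) p.
Proof.
  intros Hf Gp.
  assert (L : forall e : R * R -> R3,
    (forall w (eps : posreal) w', ball w eps w' -> ball (e w) eps (e w')) ->
    forall w, continuous e w).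
  { intros e He w P [eps HP]; exists eps; intros w' Hw'; apply HP, He, Hw'. }
  assert (C2 : forall c d, Ck 0 G (partial c (partial d f))).
  { intros c d; apply Ck_partial, Ck_partial, Hf. }
  assert (S : forall (e : R * R -> R3) (w : R * R) c d, continuous e w ->
    G (e w) ->
    @continuous _ C_UniformSpace (fun r => partial c (partial d f) (e r)) w).
  { intros e w c d Hc Ge.
    apply (@continuous_comp (prod_UniformSpace R_UniformSpace R_UniformSpace)
      _ C_UniformSpace e (partial c (partial d f))); [exact Hc|].
    destruct (C2 c d) as [C3 _]; exact (C3 _ Ge). }
  assert (E1 : forall c r, G r -> ex_partial c f r).
  { intros c r Gr; destruct Hf as [_ Hd]; destruct (Hd c) as [H _].
    exact (H r Gr). }
  assert (E2 : forall c d r, G r -> ex_partial c (partial d f) r).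
  { intros c d; apply (Ck_partial G 1 d _ Hf). }
  assert (K : forall (e : R * R -> R3) w,
    (forall w (eps : posreal) w', ball w eps w' -> ball (e w) eps (e w')) ->
    G (e w) -> locally w (fun r => G (e r))).
  { intros e w He Ge; apply (L e He w), oG, Ge. }
  assert (Comm12 : forall p, G p ->
    partial Ax (partial Ay f) p = partial Ay (partial Ax f) p).
  { intros [[x y] z] Gr; set (e := fun w : R * R => (fst w, snd w, z) : R3).
    assert (He : forall w (eps : posreal) w', ball w eps w' -> ball (e w) eps (e w')).
    { intros w eps w' [H1 H2]; repeat split; auto; apply ball_center. }
    refine (schwarz_plane (fun s t => f (s, t, z)) (fun w => G (e w)) _ _
      (K e (x, y) He Gr) _ (S e (x, y) Ax Ay (L e He (x, y)) Gr)
      (S e (x, y) Ay Ax (L e He (x, y)) Gr)).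
    intros u v Hw; repeat split;
      [exact (E1 Ax _ Hw) | exact (E1 Ay _ Hw) | exact (E2 Ax Ay _ Hw)
      | exact (E2 Ay Ax _ Hw)]. }
  assert (Comm13 : forall p, G p ->
    partial Ax (partial Az f) p = partial Az (partial Ax f) p).
  { intros [[x y] z] Gr; set (e := fun w : R * R => (fst w, y, snd w) : R3).
    assert (He : forall w (eps : posreal) w', ball w eps w' -> ball (e w) eps (e w')).
    { intros w eps w' [H1 H2]; repeat split; auto; apply ball_center. }
    refine (schwarz_plane (fun s t => f (s, y, t)) (fun w => G (e w)) _ _
      (K e (x, z) He Gr) _ (S e (x, z) Ax Az (L e He (x, z)) Gr)
      (S e (x, z) Az Ax (L e He (x, z)) Gr)).
    intros u v Hw; repeat split;
      [exact (E1 Ax _ Hw) | exact (E1 Az _ Hw) | exact (E2 Ax Az _ Hw)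
      | exact (E2 Az Ax _ Hw)]. }
  assert (Comm23 : forall p, G p ->
    partial Ay (partial Az f) p = partial Az (partial Ay f) p).
  { intros [[x y] z] Gr; set (e := fun w : R * R => (x, fst w, snd w) : R3).
    assert (He : forall w (eps : posreal) w', ball w eps w' -> ball (e w) eps (e w')).
    { intros w eps w' [H1 H2]; repeat split; auto; apply ball_center. }
    refine (schwarz_plane (fun s t => f (x, s, t)) (fun w => G (e w)) _ _
      (K e (y, z) He Gr) _ (S e (y, z) Ay Az (L e He (y, z)) Gr)
      (S e (y, z) Az Ay (L e He (y, z)) Gr)).
    intros u v Hw; repeat split;
      [exact (E1 Ay _ Hw) | exact (E1 Az _ Hw) | exact (E2 Ay Az _ Hw)
      | exact (E2 Az Ay _ Hw)]. }
  destruct a, b; auto; symmetry; auto.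
Qed.

(** * Vector calculus *)

Lemma partial_minus G a f g p :
  Ck 1 G f -> Ck 1 G g -> G p ->
  partial a (fun r => f r - g r) p = partial a f p - partial a g p.
Proof.
  intros Hf Hg Gp; apply is_partial_unique, is_partial_plus;
    [|apply is_partial_opp]; eapply Ck_is_partial; eauto.
Qed.

Lemma partial_const a c p : partial a (fun _ => c) p = 0.
Proof.
  apply is_partial_unique, is_partial_const.
Qed.

Lemma partial_scal G a c f p :
  Ck 1 G f -> G p -> partial a (fun r => c * f r) p = c * partial a f p.
Proof.
  intros Hf Gp.
  rewrite (is_partial_unique _ _ _ _ (is_partial_mult _ _ _ _ _ _
    (is_partial_const a c p) (Ck_is_partial _ _ a _ _ Hf Gp))).
  ring.
Qed.

Lemma partial_mult G a f g p :
  Ck 1 G f -> Ck 1 G g -> G p ->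
  partial a (fun r => f r * g r) p = partial a f p * g p + f p * partial a g p.
Proof.
  intros Hf Hg Gp; apply is_partial_unique, is_partial_mult;
    eapply Ck_is_partial; eauto.
Qed.

Lemma partial_comp_ext_open (G : R3 -> Prop) (oG : open G) a (h : C3 -> C) v w p :
  (forall r, G r -> v r = w r) -> G p ->
  partial a (fun r => h (v r)) p = partial a (fun r => h (w r)) p.
Proof.
  intros E Gp; apply (partial_ext_open G oG); [|exact Gp].
  intros r Gr; now rewrite E.
Qed.

Lemma rot_ext_open (G : R3 -> Prop) (oG : open G) v w p :
  (forall r, G r -> v r = w r) -> G p -> rot v p = rot w p.
Proof.
  intros E Gp.
  assert (H := fun a h => partial_comp_ext_open G oG a h v w p E Gp).
  unfold rot; rewrite (H Ax v2), (H Ax v3), (H Ay v1), (H Ay v3), (H Az v1),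
    (H Az v2).
  reflexivity.
Qed.

Lemma div_ext_open (G : R3 -> Prop) (oG : open G) v w p :
  (forall r, G r -> v r = w r) -> G p -> div v p = div w p.
Proof.
  intros E Gp.
  assert (H := fun a h => partial_comp_ext_open G oG a h v w p E Gp).
  unfold div; rewrite (H Ax v1), (H Ay v2), (H Az v3); reflexivity.
Qed.

(** In this lemma and the next, the constant factor [c] absorbs the sign that
    relates [rot v] to [f^2 grad u]. *)
Lemma rot_scal_grad (G : R3 -> Prop) (oG : open G) c u p :
  Ck 2 G u -> G p -> rot (fun r => vscal c (grad u r)) p = vzero.
Proof.
  intros Hu Gp; unfold rot, vscal, grad, vzero; cbn [v1 v2 v3].
  rewrite !(partial_scal G) by auto using Ck_partial.
  rewrite (partial_comm G oG Ay Ax), (partial_comm G oG Az Ax),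
    (partial_comm G oG Az Ay) by auto.
  f_equal; ring.
Qed.

Lemma div_scal_rot (G : R3 -> Prop) (oG : open G) c v p :
  CkV 2 G v -> G p -> div (fun r => vscal c (rot v r)) p = 0.
Proof.
  intros (H1 & H2 & H3) Gp; unfold div, vscal, rot; cbn [v1 v2 v3].
  rewrite !(partial_scal G), !(partial_minus G)
    by auto using Ck_partial, Ck_minus.
  rewrite (partial_comm G oG Ay Ax), (partial_comm G oG Az Ax),
    (partial_comm G oG Az Ay) by auto.
  ring.
Qed.

Lemma CkV_vscal (G : R3 -> Prop) (oG : open G) n c v :
  Ck n G c -> CkV n G v -> CkV n G (fun r => vscal (c r) (v r)).
Proof.
  intros Hc (H1 & H2 & H3); repeat split; apply Ck_mult; auto.
Qed.

(** The quotient rule, cleared of denominators. *)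
Lemma quotient_rule G a f g p :
  Ck 1 G f -> Ck 1 G g -> G p -> f p <> 0 ->
  f p ^ 2 * partial a (fun r => / f r * g r) p
  = f p * partial a g p - g p * partial a f p.
Proof.
  intros Hf Hg Gp Hf0.
  rewrite (is_partial_unique _ _ _ _ (is_partial_mult _ _ _ _ _ _
    (is_partial_inv _ _ _ _ (Ck_is_partial _ _ a _ _ Hf Gp) Hf0)
    (Ck_is_partial _ _ a _ _ Hg Gp))).
  field; exact Hf0.
Qed.

(** The first-order terms [grad f . grad g] produced by the two products cancel,
    so that only Laplacians remain. *)
Lemma div_f2_grad_quotient (G : R3 -> Prop) (oG : open G) f g p :
  Ck 2 G f -> Ck 2 G g -> (forall r, G r -> f r <> 0) -> G p ->
  div (fun r => vscal (f r ^ 2) (grad (fun s => / f s * g s) r)) p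
  = f p * laplacian g p - g p * laplacian f p.
Proof.
  intros Hf Hg Hf0 Gp; unfold div, laplacian; simpl v1; simpl v2; simpl v3.
  assert (E : forall a,
    partial a (fun r => f r ^ 2 * partial a (fun s => / f s * g s) r) p
    = f p * partial a (partial a g) p - g p * partial a (partial a f) p).
  { intros a.
    rewrite (partial_ext_open G oG a _
      (fun r => f r * partial a g r - g r * partial a f r)); [|intros|exact Gp].
    - rewrite (partial_minus G), !(partial_mult G)
        by auto using Ck_mult, Ck_partial, Ck_S.
      ring.
    - apply (quotient_rule G); auto using Ck_S. }
  rewrite !E; ring.
Qed.

Lemma Ceq_minus (a b : C) : a - b = 0 -> a = b.
Proof. intros H; replace a with (a - b + b) by ring; rewrite H; ring. Qed.

(** The first-order identity [rot (f Vec(W)) = - f^2 grad (W0 / f)], which is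
    [f] times the vector part of the equation satisfied by [W]. *)
Lemma rot_f_vec_part G (f : R3 -> C) (W : R3 -> HC) p :
  Ck 1 G f -> CkQ 1 G W -> G p -> f p <> 0 ->
  qsub (MT W p)
    (qmul (qdiv (MT (fun r => qscalar (f r)) p) (f p)) (qconj (W p)))
  = qscalar 0 ->
  rot (fun r => vscal (f r) (Vec (W r))) p =
  vscal (- f p ^ 2) (grad (fun r => / f r * q0 (W r)) p).
Proof.
  intros Hf (H0 & H1 & H2 & H3) Gp Hf0 E.
  simpl in H1, H2, H3.
  assert (Ex := f_equal q1 E); assert (Ey := f_equal q2 E);
    assert (Ez := f_equal q3 E); clear E.
  simpl in Ex, Ey, Ez; rewrite !partial_const in Ex, Ey, Ez.
  assert (Q : forall a, - f p ^ 2 * partial a (fun r => / f r * q0 (W r)) p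
    = q0 (W p) * partial a f p - f p * partial a (fun r => q0 (W r)) p).
  { intros a; assert (Qa := quotient_rule G a _ _ p Hf H0 Gp Hf0).
    simpl in Qa |- *.
    match type of Qa with ?l = _ => transitivity (- l) end;
      [ring | rewrite Qa; ring]. }
  unfold vscal, grad, rot; cbn [v1 v2 v3 Vec].
  rewrite !Q, !(partial_mult G) by auto.
  change (fun r : R3 => f r) with f in *.
  (* In each component, the difference of the two sides is [f p] times the
     left-hand side of the corresponding component of the equation. *)
  f_equal; apply Ceq_minus.
  - match type of Ex with ?l = _ => transitivity (f p * l) end;
      [field; exact Hf0 | rewrite Ex; ring].
  - match type of Ey with ?l = _ => transitivity (f p * l) end;
      [field; exact Hf0 | rewrite Ey; ring].
  - match type of Ez with ?l = _ => transitivity (f p * l) end;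
      [field; exact Hf0 | rewrite Ez; ring].
Qed.

Theorem theorem47 (G : R3 -> Prop) (hG : is_domain G)
    (f : R3 -> C) (hf : Ck 2 G f) (hf0 : forall p, G p -> f p <> 0)
    (W : R3 -> HC) (hW : CkQ 2 G W)
    (hWeq : forall p, G p ->
       qsub (MT W p)
            (qmul (qdiv (MT (fun r => qscalar (f r)) p) (f p)) (qconj (W p)))
       = qscalar 0) :
  let W0 := fun p => q0 (W p) in
  let nu := fun p => laplacian f p / f p in
  let u := fun p => / f p * W0 p in
  let v := fun p => vscal (f p) (Vec (W p)) in
  (Ck 2 G W0 /\
   forall p, G p -> - laplacian W0 p + nu p * W0 p = 0) /\
  (Ck 2 G u /\
   forall p, G p -> div (fun r => vscal (f r ^ 2) (grad u r)) p = 0) /\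
  (CkV 2 G v /\
   forall p, G p -> rot (fun r => vscal (/ (f r ^ 2)) (rot v r)) p = vzero).
Proof.
  intros W0 nu u v.
  destruct hG as [oG _].
  destruct hW as [hW0 hWv].
  assert (hu : Ck 2 G u) by (apply Ck_mult; auto using Ck_inv).
  assert (hv : CkV 2 G v) by (apply CkV_vscal; auto).
  assert (Key : forall p, G p -> rot v p = vscal (- f p ^ 2) (grad u p)).
  { intros p Gp; apply (rot_f_vec_part G); auto using Ck_S.
    destruct hWv as (? & ? & ?).
    split; [|split; [|split]]; apply Ck_S; auto. }
  assert (Hdiv : forall p, G p ->
    div (fun r => vscal (f r ^ 2) (grad u r)) p = 0).
  { intros p Gp.
    rewrite (div_ext_open G oG _ (fun r => vscal (- (1)) (rot v r)) p); auto.
    - apply (div_scal_rot G oG); assumption.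
    - intros r Gr; rewrite (Key r Gr); unfold vscal; simpl; f_equal; ring. }
  split; [|split]; split; auto.
  - intros p Gp.
    assert (E := Hdiv p Gp); unfold u in E.
    rewrite (div_f2_grad_quotient G oG) in E by auto.
    unfold nu; transitivity (- (f p * laplacian W0 p - W0 p * laplacian f p) / f p).
    + field; auto.
    + rewrite E; field; auto.
  - intros p Gp.
    rewrite (rot_ext_open G oG _ (fun r => vscal (- (1)) (grad u r)) p); auto.
    + apply (rot_scal_grad G oG); assumption.
    + intros r Gr; rewrite (Key r Gr); unfold vscal; simpl; f_equal; field; auto.
Qed.
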